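(* In intensional Martin-Löf type theory (without function extensionality and without propositional truncation), if every type has a constant endofunction, then every type has decidable equality: $$\Big(\prod_{X:\mathcal U}\sum_{f:X\to X}\prod_{x,y:X}f(x)=f(y)\Big)\to\prod_{X:\mathcal U}\prod_{x,y:X}\big((x=y)+\neg(x=y)\big).$$
   Context: Intensional Martin-Löf type theory with a universe $\mathcal U$ (and a larger universe containing it as needed), $\Sigma$, $\Pi$, $+$, empty type $\mathbf 0$, the booleans $\mathbf 2$, and identity types (J only; no UIP/K). $\neg A:\equiv A\to\mathbf 0$. *)

(* Defs.v *)
From Stdlib Require Import List.
Import ListNotations.

(* Intensional Martin-Löf type theory, as an object language.  The theorem is a
   derivability claim about this theory: Rocq's own [Type] could not express the
   absence of function extensionality, since a Rocq proof may appeal to axioms.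

   The presentation is that of the HoTT Book, appendix A.2, with Russell-style
   cumulative universes, but without judgmental eta, univalence, function
   extensionality or higher inductive types. *)

(* Raw terms with de Bruijn indices.  Trailing comments list the variables bound
   in an argument, outermost first: the last one listed is [Var 0]. *)
Inductive term : Type :=
| Var (n : nat)
| Univ (i : nat)
| Pi (A B : term)                 (* B: x *)
| Lam (A b : term)                (* b: x *)
| App (f a : term)
| Sig (A B : term)                (* B: x *)
| Pair (a b : term)
| SigInd (C d p : term)           (* C: z;  d: x, y *)
| Sum (A B : term)
| Inl (a : term)
| Inr (b : term)
| SumInd (C c d s : term)         (* C: z;  c: x;  d: y *)
| Empty
| EmptyInd (C e : term)           (* C: z *)
| Bool
| Ff
| Tt
| BoolInd (C c d b : term)        (* C: z *)
| Id (A a b : term)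
| Refl (a : term)
| J (C c a b p : term).           (* C: x, y, p;  c: x *)

Definition up_ren (r : nat -> nat) (n : nat) : nat :=
  match n with 0 => 0 | S m => S (r m) end.

Fixpoint ren (r : nat -> nat) (t : term) : term :=
  let r1 := up_ren r in
  let r2 := up_ren r1 in
  let r3 := up_ren r2 in
  match t with
  | Var n => Var (r n)
  | Univ i => Univ i
  | Pi A B => Pi (ren r A) (ren r1 B)
  | Lam A b => Lam (ren r A) (ren r1 b)
  | App f a => App (ren r f) (ren r a)
  | Sig A B => Sig (ren r A) (ren r1 B)
  | Pair a b => Pair (ren r a) (ren r b)
  | SigInd C d p => SigInd (ren r1 C) (ren r2 d) (ren r p)
  | Sum A B => Sum (ren r A) (ren r B)
  | Inl a => Inl (ren r a)
  | Inr b => Inr (ren r b)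
  | SumInd C c d s => SumInd (ren r1 C) (ren r1 c) (ren r1 d) (ren r s)
  | Empty => Empty
  | EmptyInd C e => EmptyInd (ren r1 C) (ren r e)
  | Bool => Bool
  | Ff => Ff
  | Tt => Tt
  | BoolInd C c d b => BoolInd (ren r1 C) (ren r c) (ren r d) (ren r b)
  | Id A a b => Id (ren r A) (ren r a) (ren r b)
  | Refl a => Refl (ren r a)
  | J C c a b p => J (ren r3 C) (ren r1 c) (ren r a) (ren r b) (ren r p)
  end.

Definition shift (k : nat) (t : term) : term := ren (fun n => k + n) t.

Definition scons (t : term) (s : nat -> term) (n : nat) : term :=
  match n with 0 => t | S m => s m end.

(* [wk k] is the substitution weakening by [k] variables; [wk 0] is the identity. *)
Definition wk (k : nat) (n : nat) : term := Var (k + n).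

Definition up (s : nat -> term) : nat -> term :=
  scons (Var 0) (fun n => shift 1 (s n)).

Fixpoint subst (s : nat -> term) (t : term) : term :=
  let s1 := up s in
  let s2 := up s1 in
  let s3 := up s2 in
  match t with
  | Var n => s n
  | Univ i => Univ i
  | Pi A B => Pi (subst s A) (subst s1 B)
  | Lam A b => Lam (subst s A) (subst s1 b)
  | App f a => App (subst s f) (subst s a)
  | Sig A B => Sig (subst s A) (subst s1 B)
  | Pair a b => Pair (subst s a) (subst s b)
  | SigInd C d p => SigInd (subst s1 C) (subst s2 d) (subst s p)
  | Sum A B => Sum (subst s A) (subst s B)
  | Inl a => Inl (subst s a)
  | Inr b => Inr (subst s b)
  | SumInd C c d u => SumInd (subst s1 C) (subst s1 c) (subst s1 d) (subst s u)
  | Empty => Empty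
  | EmptyInd C e => EmptyInd (subst s1 C) (subst s e)
  | Bool => Bool
  | Ff => Ff
  | Tt => Tt
  | BoolInd C c d b => BoolInd (subst s1 C) (subst s c) (subst s d) (subst s b)
  | Id A a b => Id (subst s A) (subst s a) (subst s b)
  | Refl a => Refl (subst s a)
  | J C c a b p => J (subst s3 C) (subst s1 c) (subst s a) (subst s b) (subst s p)
  end.

Declare Scope tt_scope.
Delimit Scope tt_scope with tt.
Open Scope tt_scope.

Notation "t .: s" := (scons t s) (at level 55, right associativity) : tt_scope.
Notation "t .[ s ]" := (subst s t)
  (at level 2, left associativity, format "t .[ s ]") : tt_scope.

Definition Arr (A B : term) : term := Pi A (shift 1 B).
Definition Neg (A : term) : term := Arr A Empty.

(* The head of a context is the type of [Var 0], living over the tail. *)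
Definition ctx : Type := list term.

Reserved Notation "'⊢' G" (at level 70).
Reserved Notation "G '⊢' t '∈' A" (at level 70, t at level 69, A at level 69).
Reserved Notation "G '⊢' t '≡' u '∈' A"
  (at level 70, t at level 69, u at level 69, A at level 69).

(* [⊢ G], [G ⊢ t ∈ A] and [G ⊢ t ≡ u ∈ A] are the three judgments:
   well-formed context, typing, and judgmental equality. *)
Inductive wf_ctx : ctx -> Prop :=
| wf_nil :
    ⊢ []
| wf_cons G A i :
    G ⊢ A ∈ Univ i ->
    ⊢ A :: G

where "'⊢' G" := (wf_ctx G) : tt_scope

with has_type : ctx -> term -> term -> Prop :=
| ty_var G n A :
    ⊢ G ->
    nth_error G n = Some A ->
    G ⊢ Var n ∈ shift (S n) A
| ty_conv G a A B i :
    G ⊢ a ∈ A ->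
    G ⊢ A ≡ B ∈ Univ i ->
    G ⊢ a ∈ B

| ty_univ G i :
    ⊢ G ->
    G ⊢ Univ i ∈ Univ (S i)
| ty_cumul G A i :
    G ⊢ A ∈ Univ i ->
    G ⊢ A ∈ Univ (S i)

| ty_pi G A B i :
    G ⊢ A ∈ Univ i ->
    A :: G ⊢ B ∈ Univ i ->
    G ⊢ Pi A B ∈ Univ i
| ty_lam G A B b :
    A :: G ⊢ b ∈ B ->
    G ⊢ Lam A b ∈ Pi A B
| ty_app G A B f a :
    G ⊢ f ∈ Pi A B ->
    G ⊢ a ∈ A ->
    G ⊢ App f a ∈ B.[a .: wk 0]

| ty_sig G A B i :
    G ⊢ A ∈ Univ i ->
    A :: G ⊢ B ∈ Univ i ->
    G ⊢ Sig A B ∈ Univ i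
| ty_pair G A B a b i :
    A :: G ⊢ B ∈ Univ i ->
    G ⊢ a ∈ A ->
    G ⊢ b ∈ B.[a .: wk 0] ->
    G ⊢ Pair a b ∈ Sig A B
| ty_sigind G A B C d p i :
    Sig A B :: G ⊢ C ∈ Univ i ->
    B :: A :: G ⊢ d ∈ C.[Pair (Var 1) (Var 0) .: wk 2] ->
    G ⊢ p ∈ Sig A B ->
    G ⊢ SigInd C d p ∈ C.[p .: wk 0]

| ty_sum G A B i :
    G ⊢ A ∈ Univ i ->
    G ⊢ B ∈ Univ i ->
    G ⊢ Sum A B ∈ Univ i
| ty_inl G A B a i :
    G ⊢ A ∈ Univ i ->
    G ⊢ B ∈ Univ i ->
    G ⊢ a ∈ A ->
    G ⊢ Inl a ∈ Sum A B
| ty_inr G A B b i :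
    G ⊢ A ∈ Univ i ->
    G ⊢ B ∈ Univ i ->
    G ⊢ b ∈ B ->
    G ⊢ Inr b ∈ Sum A B
| ty_sumind G A B C c d s i :
    Sum A B :: G ⊢ C ∈ Univ i ->
    A :: G ⊢ c ∈ C.[Inl (Var 0) .: wk 1] ->
    B :: G ⊢ d ∈ C.[Inr (Var 0) .: wk 1] ->
    G ⊢ s ∈ Sum A B ->
    G ⊢ SumInd C c d s ∈ C.[s .: wk 0]

| ty_empty G i :
    ⊢ G ->
    G ⊢ Empty ∈ Univ i
| ty_emptyind G C e i :
    Empty :: G ⊢ C ∈ Univ i ->
    G ⊢ e ∈ Empty ->
    G ⊢ EmptyInd C e ∈ C.[e .: wk 0]

| ty_bool G i :
    ⊢ G ->
    G ⊢ Bool ∈ Univ i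
| ty_ff G :
    ⊢ G ->
    G ⊢ Ff ∈ Bool
| ty_tt G :
    ⊢ G ->
    G ⊢ Tt ∈ Bool
| ty_boolind G C c d b i :
    Bool :: G ⊢ C ∈ Univ i ->
    G ⊢ c ∈ C.[Ff .: wk 0] ->
    G ⊢ d ∈ C.[Tt .: wk 0] ->
    G ⊢ b ∈ Bool ->
    G ⊢ BoolInd C c d b ∈ C.[b .: wk 0]

| ty_id G A a b i :
    G ⊢ A ∈ Univ i ->
    G ⊢ a ∈ A ->
    G ⊢ b ∈ A ->
    G ⊢ Id A a b ∈ Univ i
| ty_refl G A a :
    G ⊢ a ∈ A ->
    G ⊢ Refl a ∈ Id A a a
| ty_J G A C c a b p i :
    Id (shift 2 A) (Var 1) (Var 0) :: shift 1 A :: A :: G ⊢ C ∈ Univ i ->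
    A :: G ⊢ c ∈ C.[Refl (Var 0) .: Var 0 .: Var 0 .: wk 1] ->
    G ⊢ a ∈ A ->
    G ⊢ b ∈ A ->
    G ⊢ p ∈ Id A a b ->
    G ⊢ J C c a b p ∈ C.[p .: b .: a .: wk 0]

where "G '⊢' t '∈' A" := (has_type G t A) : tt_scope

with eq_term : ctx -> term -> term -> term -> Prop :=
| eq_refl' G a A :
    G ⊢ a ∈ A ->
    G ⊢ a ≡ a ∈ A
| eq_sym' G a b A :
    G ⊢ a ≡ b ∈ A ->
    G ⊢ b ≡ a ∈ A
| eq_trans' G a b c A :
    G ⊢ a ≡ b ∈ A ->
    G ⊢ b ≡ c ∈ A ->
    G ⊢ a ≡ c ∈ A
| eq_conv G a b A B i :
    G ⊢ a ≡ b ∈ A ->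
    G ⊢ A ≡ B ∈ Univ i ->
    G ⊢ a ≡ b ∈ B
| eq_cumul G A B i :
    G ⊢ A ≡ B ∈ Univ i ->
    G ⊢ A ≡ B ∈ Univ (S i)

(* computation rules *)
| beta_pi G A B b a :
    A :: G ⊢ b ∈ B ->
    G ⊢ a ∈ A ->
    G ⊢ App (Lam A b) a ≡ b.[a .: wk 0] ∈ B.[a .: wk 0]
| beta_sig G A B C d a b i :
    Sig A B :: G ⊢ C ∈ Univ i ->
    B :: A :: G ⊢ d ∈ C.[Pair (Var 1) (Var 0) .: wk 2] ->
    G ⊢ a ∈ A ->
    G ⊢ b ∈ B.[a .: wk 0] ->
    G ⊢ SigInd C d (Pair a b) ≡ d.[b .: a .: wk 0] ∈ C.[Pair a b .: wk 0]
| beta_inl G A B C c d a i :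
    Sum A B :: G ⊢ C ∈ Univ i ->
    A :: G ⊢ c ∈ C.[Inl (Var 0) .: wk 1] ->
    B :: G ⊢ d ∈ C.[Inr (Var 0) .: wk 1] ->
    G ⊢ a ∈ A ->
    G ⊢ SumInd C c d (Inl a) ≡ c.[a .: wk 0] ∈ C.[Inl a .: wk 0]
| beta_inr G A B C c d b i :
    Sum A B :: G ⊢ C ∈ Univ i ->
    A :: G ⊢ c ∈ C.[Inl (Var 0) .: wk 1] ->
    B :: G ⊢ d ∈ C.[Inr (Var 0) .: wk 1] ->
    G ⊢ b ∈ B ->
    G ⊢ SumInd C c d (Inr b) ≡ d.[b .: wk 0] ∈ C.[Inr b .: wk 0]
| beta_ff G C c d i :
    Bool :: G ⊢ C ∈ Univ i ->
    G ⊢ c ∈ C.[Ff .: wk 0] ->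
    G ⊢ d ∈ C.[Tt .: wk 0] ->
    G ⊢ BoolInd C c d Ff ≡ c ∈ C.[Ff .: wk 0]
| beta_tt G C c d i :
    Bool :: G ⊢ C ∈ Univ i ->
    G ⊢ c ∈ C.[Ff .: wk 0] ->
    G ⊢ d ∈ C.[Tt .: wk 0] ->
    G ⊢ BoolInd C c d Tt ≡ d ∈ C.[Tt .: wk 0]
| beta_id G A C c a i :
    Id (shift 2 A) (Var 1) (Var 0) :: shift 1 A :: A :: G ⊢ C ∈ Univ i ->
    A :: G ⊢ c ∈ C.[Refl (Var 0) .: Var 0 .: Var 0 .: wk 1] ->
    G ⊢ a ∈ A ->
    G ⊢ J C c a a (Refl a) ≡ c.[a .: wk 0] ∈ C.[Refl a .: a .: a .: wk 0]

(* congruence rules *)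
| cong_pi G A A' B B' i :
    G ⊢ A ≡ A' ∈ Univ i ->
    A :: G ⊢ B ≡ B' ∈ Univ i ->
    G ⊢ Pi A B ≡ Pi A' B' ∈ Univ i
| cong_lam G A A' B b b' i :
    G ⊢ A ≡ A' ∈ Univ i ->
    A :: G ⊢ b ≡ b' ∈ B ->
    G ⊢ Lam A b ≡ Lam A' b' ∈ Pi A B
| cong_app G A B f f' a a' :
    G ⊢ f ≡ f' ∈ Pi A B ->
    G ⊢ a ≡ a' ∈ A ->
    G ⊢ App f a ≡ App f' a' ∈ B.[a .: wk 0]
| cong_sig G A A' B B' i :
    G ⊢ A ≡ A' ∈ Univ i ->
    A :: G ⊢ B ≡ B' ∈ Univ i ->
    G ⊢ Sig A B ≡ Sig A' B' ∈ Univ i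
| cong_pair G A B a a' b b' i :
    A :: G ⊢ B ∈ Univ i ->
    G ⊢ a ≡ a' ∈ A ->
    G ⊢ b ≡ b' ∈ B.[a .: wk 0] ->
    G ⊢ Pair a b ≡ Pair a' b' ∈ Sig A B
| cong_sigind G A B C C' d d' p p' i :
    Sig A B :: G ⊢ C ≡ C' ∈ Univ i ->
    B :: A :: G ⊢ d ≡ d' ∈ C.[Pair (Var 1) (Var 0) .: wk 2] ->
    G ⊢ p ≡ p' ∈ Sig A B ->
    G ⊢ SigInd C d p ≡ SigInd C' d' p' ∈ C.[p .: wk 0]
| cong_sum G A A' B B' i :
    G ⊢ A ≡ A' ∈ Univ i ->
    G ⊢ B ≡ B' ∈ Univ i ->
    G ⊢ Sum A B ≡ Sum A' B' ∈ Univ i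
| cong_inl G A B a a' i :
    G ⊢ A ∈ Univ i ->
    G ⊢ B ∈ Univ i ->
    G ⊢ a ≡ a' ∈ A ->
    G ⊢ Inl a ≡ Inl a' ∈ Sum A B
| cong_inr G A B b b' i :
    G ⊢ A ∈ Univ i ->
    G ⊢ B ∈ Univ i ->
    G ⊢ b ≡ b' ∈ B ->
    G ⊢ Inr b ≡ Inr b' ∈ Sum A B
| cong_sumind G A B C C' c c' d d' s s' i :
    Sum A B :: G ⊢ C ≡ C' ∈ Univ i ->
    A :: G ⊢ c ≡ c' ∈ C.[Inl (Var 0) .: wk 1] ->
    B :: G ⊢ d ≡ d' ∈ C.[Inr (Var 0) .: wk 1] ->
    G ⊢ s ≡ s' ∈ Sum A B ->
    G ⊢ SumInd C c d s ≡ SumInd C' c' d' s' ∈ C.[s .: wk 0]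
| cong_emptyind G C C' e e' i :
    Empty :: G ⊢ C ≡ C' ∈ Univ i ->
    G ⊢ e ≡ e' ∈ Empty ->
    G ⊢ EmptyInd C e ≡ EmptyInd C' e' ∈ C.[e .: wk 0]
| cong_boolind G C C' c c' d d' b b' i :
    Bool :: G ⊢ C ≡ C' ∈ Univ i ->
    G ⊢ c ≡ c' ∈ C.[Ff .: wk 0] ->
    G ⊢ d ≡ d' ∈ C.[Tt .: wk 0] ->
    G ⊢ b ≡ b' ∈ Bool ->
    G ⊢ BoolInd C c d b ≡ BoolInd C' c' d' b' ∈ C.[b .: wk 0]
| cong_id G A A' a a' b b' i :
    G ⊢ A ≡ A' ∈ Univ i ->
    G ⊢ a ≡ a' ∈ A ->
    G ⊢ b ≡ b' ∈ A ->
    G ⊢ Id A a b ≡ Id A' a' b' ∈ Univ i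
| cong_refl G A a a' :
    G ⊢ a ≡ a' ∈ A ->
    G ⊢ Refl a ≡ Refl a' ∈ Id A a a
| cong_J G A C C' c c' a a' b b' p p' i :
    Id (shift 2 A) (Var 1) (Var 0) :: shift 1 A :: A :: G ⊢ C ≡ C' ∈ Univ i ->
    A :: G ⊢ c ≡ c' ∈ C.[Refl (Var 0) .: Var 0 .: Var 0 .: wk 1] ->
    G ⊢ a ≡ a' ∈ A ->
    G ⊢ b ≡ b' ∈ A ->
    G ⊢ p ≡ p' ∈ Id A a b ->
    G ⊢ J C c a b p ≡ J C' c' a' b' p' ∈ C.[p .: b .: a .: wk 0]

where "G '⊢' t '≡' u '∈' A" := (eq_term G t u A) : tt_scope.

(* Π (X : U_i), Σ (f : X → X), Π (x y : X), f x = f y *)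
Definition every_type_has_constant_endofunction (i : nat) : term :=
  Pi (Univ i)
    (Sig (Arr (Var 0) (Var 0))
      (Pi (Var 1) (Pi (Var 2)
        (Id (Var 3) (App (Var 2) (Var 1)) (App (Var 2) (Var 0)))))).

(* Π (X : U_i), Π (x y : X), (x = y) + ¬ (x = y) *)
Definition every_type_has_decidable_equality (i : nat) : term :=
  Pi (Univ i) (Pi (Var 0) (Pi (Var 1)
    (Sum (Id (Var 2) (Var 1) (Var 0)) (Neg (Id (Var 2) (Var 1) (Var 0)))))).

(* Main.v *)
Require Import Defs.
From Stdlib Require Import List.
Import ListNotations.

(** Given [a b : X], let [E x] be the type [(a = x) + (b = x)], and let [g x] be the
    given constant endofunction of [E x].  Look at [u := g a (inl refl)] and
    [v := g b (inr refl)].  If [u] is a right injection or [v] a left one, it carries an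
    identification of [a] with [b].  Otherwise [u] is a left injection and [v] a right
    one, and then [a <> b]: by path induction and constancy of [g x], an element of
    [a = b] would put [u] and [v] on the same side. *)

(** * Terms realizing the argument *)

Definition constancy (X f : term) : term :=
  Pi X (Pi (shift 1 X)
    (Id (shift 2 X) (App (shift 2 f) (Var 1)) (App (shift 2 f) (Var 0)))).

Definition const_endo (X : term) : term :=
  Sig (Arr X X) (constancy (shift 1 X) (Var 0)).

Definition endo_fun (X w : term) : term := SigInd (shift 1 (Arr X X)) (Var 1) w.

(** The second projection, [endo_fun] being the first. Its type mentions [endo_fun] of the same
    pair, hence the dependent motive. *)
Definition endo_const (i : nat) : term :=
  Lam (Univ i) (Lam (const_endo (Var 0))
    (SigInd (constancy (Var 2) (endo_fun (Var 2) (Var 0))) (Var 0) (Var 0))).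

Definition two_point_fiber (X a b x : term) : term := Sum (Id X a x) (Id X b x).

(* Inhabited on left injections and empty on right ones. *)
Definition is_left (i : nat) (s : term) : term := SumInd (Univ i) Bool Empty s.

Definition decision (X a b : term) : term := Sum (Id X a b) (Neg (Id X a b)).

Definition separation (i : nat) (X a b u v : term) : term :=
  Arr (Id X a b) (Arr (is_left i u) (is_left i v)).

Definition path_inv (X p a b : term) : term :=
  J (Id (shift 3 X) (Var 1) (Var 2)) (Refl (Var 0)) a b p.

(** Records the side as a fact about the given element itself, which a case split with a constant
    motive would lose. *)
Definition left_or (i : nat) : term :=
  Lam (Univ i) (Lam (Univ i) (Lam (Sum (Var 1) (Var 0))
    (SumInd (Sum (is_left i (Var 0)) (Var 2)) (Inl Tt) (Inr (Var 0)) (Var 0)))).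

Definition or_not_left (i : nat) : term :=
  Lam (Univ i) (Lam (Univ i) (Lam (Sum (Var 1) (Var 0))
    (SumInd (Sum (Var 3) (Neg (is_left i (Var 0))))
      (Inl (Var 0))
      (Inr (Lam (is_left i (Inr (Var 0))) (Var 0)))
      (Var 0)))).

(** Here [u] and [v] are variables. [left_or] splits on [u], whose right side lies in [b = a], hence
    [path_inv]; [or_not_left] splits on [v]. *)
Definition decide_by_sides (i : nat) : term :=
  Lam (Univ i) (Lam (Var 0) (Lam (Var 1)
    (Lam (two_point_fiber (Var 2) (Var 1) (Var 0) (Var 1))
    (Lam (two_point_fiber (Var 3) (Var 2) (Var 1) (Var 1))
    (Lam (separation i (Var 4) (Var 3) (Var 2) (Var 1) (Var 0))
      (SumInd (decision (Var 6) (Var 5) (Var 4))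
        (SumInd (decision (Var 7) (Var 6) (Var 5))
          (Inl (Var 0))
          (Inr (Lam (Id (Var 7) (Var 6) (Var 5))
            (App (Var 1) (App (App (Var 3) (Var 0)) (Var 2)))))
          (App (App (App (or_not_left i)
            (Id (Var 6) (Var 5) (Var 4))) (Id (Var 6) (Var 4) (Var 4))) (Var 2)))
        (Inl (path_inv (Var 6) (Var 0) (Var 4) (Var 5)))
        (App (App (App (left_or i)
          (Id (Var 5) (Var 4) (Var 4))) (Id (Var 5) (Var 3) (Var 4))) (Var 2)))))))).

(* [F] is the hypothesis of the theorem, a choice of constant endofunctions. *)
Definition fiber_endo (F X a b x : term) : term :=
  let E := two_point_fiber X a b x in endo_fun E (App F E).

(** An open term: [Var 4] to [Var 0] stand for [F], [X], [a], [b] and a path from [a] to [b]. The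
    outer motive quantifies over points of both fibers, since [inl refl] typechecks only over [a]
    and [inr refl] only over [b]. On the diagonal, the inner [J] transports along constancy. *)
Definition same_side (i : nat) : term :=
  J (Pi (two_point_fiber (Var 6) (Var 5) (Var 4) (Var 2))
      (Pi (two_point_fiber (Var 7) (Var 6) (Var 5) (Var 2))
        (Arr
          (is_left i (App (fiber_endo (Var 9) (Var 8) (Var 7) (Var 6) (Var 4)) (Var 1)))
          (is_left i (App (fiber_endo (Var 9) (Var 8) (Var 7) (Var 6) (Var 3)) (Var 0))))))
    (Lam (two_point_fiber (Var 4) (Var 3) (Var 2) (Var 0))
      (Lam (two_point_fiber (Var 5) (Var 4) (Var 3) (Var 1))
        (J (Arr (is_left i (Var 2)) (is_left i (Var 1)))
          (Lam (is_left i (Var 0)) (Var 0))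
          (App (fiber_endo (Var 7) (Var 6) (Var 5) (Var 4) (Var 2)) (Var 1))
          (App (fiber_endo (Var 7) (Var 6) (Var 5) (Var 4) (Var 2)) (Var 0))
          (let E := two_point_fiber (Var 6) (Var 5) (Var 4) (Var 2) in
           App (App (App (App (endo_const i) E) (App (Var 7) E)) (Var 1)) (Var 0)))))
    (Var 2) (Var 1) (Var 0).

Definition decidable_equality_term (i : nat) : term :=
  Lam (every_type_has_constant_endofunction i)
    (Lam (Univ i) (Lam (Var 0) (Lam (Var 1)
      (App (App (App (App (App (App (decide_by_sides i) (Var 2)) (Var 1)) (Var 0))
        (App (fiber_endo (Var 3) (Var 2) (Var 1) (Var 0) (Var 1)) (Inl (Refl (Var 1)))))
        (App (fiber_endo (Var 3) (Var 2) (Var 1) (Var 0) (Var 0)) (Inr (Refl (Var 0)))))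
        (Lam (Id (Var 2) (Var 1) (Var 0))
          (App (App (same_side i) (Inl (Refl (Var 2)))) (Inr (Refl (Var 1))))))))).

(* Variants of the typing rules for syntax-directed search: what determines the
   remaining types comes first, well-formedness of extended contexts becomes a
   hypothesis of the later premises, and types are compared up to computation of
   substitutions. *)

Lemma infer_var G n A B :
  ⊢ G -> nth_error G n = Some A -> B = shift (S n) A -> G ⊢ Var n ∈ B.
Proof. intros HG HA ->; now apply ty_var. Qed.

Lemma infer_pi G A B i :
  G ⊢ A ∈ Univ i -> (⊢ A :: G -> A :: G ⊢ B ∈ Univ i) -> G ⊢ Pi A B ∈ Univ i.
Proof. intros HA HB; apply ty_pi; eauto using wf_cons. Qed.

Lemma infer_sig G A B i :
  G ⊢ A ∈ Univ i -> (⊢ A :: G -> A :: G ⊢ B ∈ Univ i) -> G ⊢ Sig A B ∈ Univ i.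
Proof. intros HA HB; apply ty_sig; eauto using wf_cons. Qed.

Lemma infer_lam G A B b j :
  G ⊢ A ∈ Univ j -> (⊢ A :: G -> A :: G ⊢ b ∈ B) -> G ⊢ Lam A b ∈ Pi A B.
Proof. intros HA Hb; apply ty_lam; eauto using wf_cons. Qed.

Lemma infer_app G A B T f a :
  G ⊢ f ∈ Pi A B -> G ⊢ a ∈ A -> T = B.[a .: wk 0] -> G ⊢ App f a ∈ T.
Proof. intros Hf Ha ->; now apply ty_app with A. Qed.

Lemma infer_sigind i G A B C T d p :
  G ⊢ p ∈ Sig A B ->
  G ⊢ A ∈ Univ i ->
  (⊢ A :: G -> A :: G ⊢ B ∈ Univ i) ->
  (⊢ Sig A B :: G -> exists j, Sig A B :: G ⊢ C ∈ Univ j) ->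
  (⊢ B :: A :: G -> B :: A :: G ⊢ d ∈ C.[Pair (Var 1) (Var 0) .: wk 2]) ->
  T = C.[p .: wk 0] ->
  G ⊢ SigInd C d p ∈ T.
Proof.
  intros Hp HA HB HC Hd ->.
  assert (HAG : ⊢ A :: G) by eauto using wf_cons.
  destruct HC as [j HC]; [eauto using wf_cons, ty_sig |].
  apply ty_sigind with A B j; eauto using wf_cons.
Qed.

Lemma infer_sumind i G A B C T c d s :
  G ⊢ s ∈ Sum A B ->
  G ⊢ A ∈ Univ i ->
  G ⊢ B ∈ Univ i ->
  (⊢ Sum A B :: G -> exists j, Sum A B :: G ⊢ C ∈ Univ j) ->
  (⊢ A :: G -> A :: G ⊢ c ∈ C.[Inl (Var 0) .: wk 1]) ->
  (⊢ B :: G -> B :: G ⊢ d ∈ C.[Inr (Var 0) .: wk 1]) ->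
  T = C.[s .: wk 0] ->
  G ⊢ SumInd C c d s ∈ T.
Proof.
  intros Hs HA HB HC Hc Hd ->.
  destruct HC as [j HC]; [eauto using wf_cons, ty_sum |].
  apply ty_sumind with A B j; eauto using wf_cons.
Qed.

Lemma infer_J i G A C T c a b p :
  G ⊢ p ∈ Id A a b ->
  G ⊢ A ∈ Univ i ->
  G ⊢ a ∈ A ->
  G ⊢ b ∈ A ->
  (⊢ A :: G -> A :: G ⊢ shift 1 A ∈ Univ i) ->
  (⊢ shift 1 A :: A :: G ->
     shift 1 A :: A :: G ⊢ Id (shift 2 A) (Var 1) (Var 0) ∈ Univ i) ->
  (⊢ Id (shift 2 A) (Var 1) (Var 0) :: shift 1 A :: A :: G ->
     Id (shift 2 A) (Var 1) (Var 0) :: shift 1 A :: A :: G ⊢ C ∈ Univ i) ->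
  (⊢ A :: G -> A :: G ⊢ c ∈ C.[Refl (Var 0) .: Var 0 .: Var 0 .: wk 1]) ->
  T = C.[p .: b .: a .: wk 0] ->
  G ⊢ J C c a b p ∈ T.
Proof.
  intros Hp HA Ha Hb H1 H2 HC Hc ->.
  assert (HAG : ⊢ A :: G) by eauto using wf_cons.
  apply ty_J with A i; eauto 6 using wf_cons.
Qed.

Ltac normalize := cbn; reflexivity.

(* [typecheck i] checks [G ⊢ t ∈ A], inferring [A] if it is an existential variable;
   motives and the types eliminated from are taken in [Univ i], except that a
   motive may be [Univ i] itself.  It computes substitutions only: subgoals that need
   a judgmental conversion are left over. *)
Ltac typecheck i :=
  cbn;
  lazymatch goal with
  | |- _ = _ => normalize
  | |- ⊢ _ => eassumption
  | |- ⊢ _ -> _ => let H := fresh "wf" in intro H; cbn in H; typecheck i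
  | |- exists j, _ ⊢ Univ _ ∈ Univ j => exists (S i); typecheck i
  | |- exists j, _ => exists i; typecheck i
  | |- _ ⊢ Var _ ∈ Univ (S i) => apply ty_cumul; typecheck i
  | |- _ ⊢ Var _ ∈ _ => 
      try solve [eapply infer_var; [eassumption | first [reflexivity | eassumption] | normalize]]
  | |- _ ⊢ Univ _ ∈ _ => apply ty_univ; eassumption
  | |- _ ⊢ Pi _ _ ∈ _ => apply infer_pi; typecheck i
  | |- _ ⊢ Sig _ _ ∈ _ => apply infer_sig; typecheck i
  | |- _ ⊢ Sum _ _ ∈ _ => apply ty_sum; typecheck i
  | |- _ ⊢ Empty ∈ _ => apply ty_empty; eassumption
  | |- _ ⊢ Bool ∈ _ => apply ty_bool; eassumption
  | |- _ ⊢ Tt ∈ _ => try (apply ty_tt; eassumption)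
  | |- _ ⊢ Id _ _ _ ∈ _ => apply ty_id; typecheck i
  | |- _ ⊢ Lam (Univ _) _ ∈ _ => eapply infer_lam with (j := S i); typecheck i
  | |- _ ⊢ Lam _ _ ∈ _ => eapply infer_lam with (j := i); typecheck i
  | |- _ ⊢ App _ _ ∈ _ => 
      try solve [eapply infer_app; [typecheck i | typecheck i | normalize]]
  | |- _ ⊢ Inl _ ∈ _ => apply ty_inl with i; typecheck i
  | |- _ ⊢ Inr _ ∈ _ => apply ty_inr with i; typecheck i
  | |- _ ⊢ Refl _ ∈ _ => eapply ty_refl; typecheck i
  | |- _ ⊢ SigInd _ _ _ ∈ _ => eapply (infer_sigind i); typecheck i
  | |- _ ⊢ SumInd _ _ _ (Inl _) ∈ _ => idtac
  | |- _ ⊢ SumInd _ _ _ (Inr _) ∈ _ => idtac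
  | |- _ ⊢ SumInd _ _ _ _ ∈ _ => eapply (infer_sumind i); typecheck i
  | |- _ ⊢ J _ _ _ _ _ ∈ _ => eapply (infer_J i); typecheck i
  | H : forall G, ⊢ G -> G ⊢ ?t ∈ _ |- _ ⊢ ?t ∈ _ => eapply H; eassumption
  | |- ?G ⊢ ?t ∈ ?A => 
      let t' := eval hnf in t in progress change (G ⊢ t' ∈ A); typecheck i
  end.

(** * Typing of the constituent terms *)

Lemma is_left_type i G A B s :
  ⊢ G -> G ⊢ A ∈ Univ i -> G ⊢ B ∈ Univ i -> G ⊢ s ∈ Sum A B ->
  G ⊢ is_left i s ∈ Univ i.
Proof.
  intros HG HA HB Hs.
  apply (infer_sumind i) with A B; try assumption; typecheck i.
Qed.

Lemma is_left_inl i G A B a :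
  ⊢ G -> G ⊢ A ∈ Univ i -> G ⊢ B ∈ Univ i -> G ⊢ a ∈ A ->
  G ⊢ is_left i (Inl a) ≡ Bool ∈ Univ i.
Proof.
  intros HG HA HB Ha.
  apply (beta_inl G A B (Univ i) Bool Empty a (S i));
    try assumption; constructor; eauto using wf_cons, ty_sum.
Qed.

Lemma is_left_inr i G A B b :
  ⊢ G -> G ⊢ A ∈ Univ i -> G ⊢ B ∈ Univ i -> G ⊢ b ∈ B ->
  G ⊢ is_left i (Inr b) ≡ Empty ∈ Univ i.
Proof.
  intros HG HA HB Hb.
  apply (beta_inr G A B (Univ i) Bool Empty b (S i));
    try assumption; constructor; eauto using wf_cons, ty_sum.
Qed.

Lemma left_or_type i G :
  ⊢ G ->
  G ⊢ left_or i ∈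
    Pi (Univ i) (Pi (Univ i) (Pi (Sum (Var 1) (Var 0))
      (Sum (is_left i (Var 0)) (Var 1)))).
Proof.
  intros HG. typecheck i.
  (* An explicit injection does not determine the other summand, so [is_left] of it is typed by
     hand. *)
  - apply is_left_type with (Var 3) (Var 2); typecheck i.
  - apply ty_conv with Bool i; [typecheck i |].
    apply eq_sym', is_left_inl with (Var 3) (Var 2); typecheck i.
  - apply is_left_type with (Var 3) (Var 2); typecheck i.
Qed.

Lemma or_not_left_type i G :
  ⊢ G ->
  G ⊢ or_not_left i ∈
    Pi (Univ i) (Pi (Univ i) (Pi (Sum (Var 1) (Var 0))
      (Sum (Var 2) (Neg (is_left i (Var 0)))))).
Proof.
  intros HG. typecheck i.
  1-3: apply is_left_type with (Var 3) (Var 2); typecheck i.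
  (* The identity serves as the negation because [is_left] of a right injection computes to
     [Empty]. *)
  apply ty_conv with (is_left i (Inr (Var 1))) i; [typecheck i |].
  apply is_left_inr with (Var 4) (Var 3); typecheck i.
Qed.

Lemma decide_by_sides_type i G :
  ⊢ G ->
  G ⊢ decide_by_sides i ∈
    Pi (Univ i) (Pi (Var 0) (Pi (Var 1)
      (Pi (two_point_fiber (Var 2) (Var 1) (Var 0) (Var 1))
      (Pi (two_point_fiber (Var 3) (Var 2) (Var 1) (Var 1))
        (Arr (separation i (Var 4) (Var 3) (Var 2) (Var 1) (Var 0))
             (decision (Var 4) (Var 3) (Var 2))))))).
Proof.
  intros HG.
  pose proof (left_or_type i). pose proof (or_not_left_type i).
  typecheck i.
Qed.

(** Lets a constancy proof for the bare function serve for [endo_fun] of the pair. *)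
Lemma app_endo_fun_pair i G n f c a :
  ⊢ G -> nth_error G n = Some (Univ i) ->
  G ⊢ Var f ∈ Arr (Var n) (Var n) -> G ⊢ c ∈ constancy (Var n) (Var f) ->
  G ⊢ a ∈ Var n ->
  G ⊢ App (endo_fun (Var n) (Pair (Var f) c)) a ≡ App (Var f) a ∈ Var n.
Proof.
  intros HG Hn Hf Hc Ha.
  assert (⊢ Arr (Var n) (Var n) :: G) by (apply wf_cons with i; typecheck i).
  assert (⊢ const_endo (Var n) :: G) by (apply wf_cons with i; typecheck i).
  assert (⊢ constancy (Var (S n)) (Var 0) :: Arr (Var n) (Var n) :: G)
    by (apply wf_cons with i; typecheck i).
  apply (cong_app G (Var n) (Var (S n))); [| now apply eq_refl'].
  apply (beta_sig G (Arr (Var n) (Var n)) (constancy (Var (S n)) (Var 0))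
    (Arr (Var (S n)) (Var (S n))) (Var 1) (Var f) c i);
    [typecheck i | typecheck i | exact Hf | exact Hc].
Qed.

Lemma endo_const_type i G :
  ⊢ G ->
  G ⊢ endo_const i ∈
    Pi (Univ i) (Pi (const_endo (Var 0))
      (constancy (Var 1) (endo_fun (Var 1) (Var 0)))).
Proof.
  intros HG. typecheck i.
  apply ty_conv with (constancy (Var 3) (Var 1)) i; [typecheck i |].
  match goal with |- ?D ⊢ _ ≡ _ ∈ _ =>
    assert (⊢ Var 3 :: D) by (apply wf_cons with i; typecheck i);
    assert (⊢ Var 4 :: Var 3 :: D) by (apply wf_cons with i; typecheck i)
  end.
  apply cong_pi; [apply eq_refl'; typecheck i |].
  apply cong_pi; [apply eq_refl'; typecheck i |].
  apply cong_id; [apply eq_refl'; typecheck i | |].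
  (* Below the two bound points, [Var 5], [Var 3] and [Var 2] are the type, the function and its
     constancy. *)
  all: apply eq_sym', (app_endo_fun_pair i _ 5 3 (Var 2)); typecheck i.
Qed.

Theorem theorem7p2 (i : nat) :
  exists t : term,
    [] ⊢ t ∈ Arr (every_type_has_constant_endofunction i)
                 (every_type_has_decidable_equality i).
Proof.
  exists (decidable_equality_term i).
  pose proof wf_nil.
  pose proof (decide_by_sides_type i). pose proof (endo_const_type i).
  (* The hypothesis quantifies over [Univ i], so its type lives one universe higher. *)
  apply infer_lam with (j := S i); typecheck i.
Qed.
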